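(* Fix diagonal matrices $\Lambda_A=\mathrm{diag}(\lambda_1(A),\lambda_2(A),\lambda_3(A))$ and $\Lambda_B=\mathrm{diag}(\lambda_1(B),\lambda_2(B),\lambda_3(B))$ with $\lambda_1(A)>\lambda_2(A)>\lambda_3(A)$ and $\lambda_1(B)>\lambda_2(B)>\lambda_3(B)$. For $Q_A,Q_B\in SO(3)$ put $A=Q_A^T\Lambda_AQ_A$, $B=Q_B^T\Lambda_BQ_B$ and write $R=Q_AQ_B^T=\exp(\theta K)$, where $\theta\in(-\pi,\pi)$ and $K$ is the skew-symmetric cross-product matrix of a unit vector $k\in\mathbb{R}^3$. Then $$d_R(Q_A,Q_B)^2=\frac{d_C(A,B)^2}{C(K,\Lambda_A,\Lambda_B)}+O(\theta^3)\qquad\text{as }\theta\to0,$$ where the constant implied by $O(\theta^3)$ depends only on the fixed matrices $\Lambda_A,\Lambda_B$, and $$C(K,\Lambda_A,\Lambda_B):=2\,\mathrm{tr}\left(\Lambda_A^2K^2\Lambda_B^2-\Lambda_A^2K\Lambda_B^2K\right)-4\,\mathrm{tr}\left(K\Lambda_A\Lambda_BK\Lambda_A\Lambda_B+K^2\Lambda_A^2\Lambda_B^2-K\Lambda_AK\Lambda_A\Lambda_B^2-K\Lambda_BK\Lambda_B\Lambda_A^2\right).$$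
   Context: $\|X\|=(\mathrm{tr}(XX^T))^{1/2}$ is the Frobenius norm, $[A,B]=AB-BA$, and $d_C(A,B):=\|[A,B]\|$. The cross-product matrix of $k$ is the skew-symmetric $K\in\mathbb{R}^{3\times3}$ with $Kx=k\times x$ for all $x\in\mathbb{R}^3$; then $\exp(\theta K)=I+\sin\theta\,K+(1-\cos\theta)K^2$. The Riemannian metric on $SO(3)$ is $d_R(Q_A,Q_B)=\frac{1}{\sqrt2}\|\log(Q_AQ_B^T)\|$ (principal logarithm), so that $d_R(Q_A,Q_B)=|\theta|$. *)

(* Defs.v *)
From HB Require Import structures.
From mathcomp Require Import all_boot all_order all_algebra complex.
From mathcomp Require Import all_classical all_reals all_analysis.

Set Implicit Arguments.
Unset Strict Implicit.
Unset Printing Implicit Defensive.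

Import Order.TTheory GRing.Theory Num.Theory.
Import numFieldNormedType.Exports.

Local Open Scope classical_set_scope.
Local Open Scope ring_scope.

(* The canonical MathComp-Analysis norm [`|X|] on matrices is the sup norm, so
   the Frobenius norm is introduced separately; on a column vector it is the
   Euclidean norm. *)
Definition frobnorm {R : realType} {m n : nat} (X : 'M[R]_(m, n)) : R :=
  Num.sqrt (\tr (X *m X^T)).

Definition commutator {R : realType} {n : nat} (A B : 'M[R]_n) : 'M[R]_n :=
  A *m B - B *m A.

Definition dC {R : realType} {n : nat} (A B : 'M[R]_n) : R :=
  frobnorm (commutator A B).

Definition SO {R : realType} {n : nat} : set 'M[R]_n :=
  [set Q | Q *m Q^T = 1%:M /\ \det Q = 1].

(* Indices live in Z/3, so this is the usual
   (u1 v2 - u2 v1, u2 v0 - u0 v2, u0 v1 - u1 v0). *)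
Definition crossv {R : realType} (u v : 'cV[R]_3) : 'cV[R]_3 :=
  \col_i (u (i + 1) 0 * v (i + 2) 0 - u (i + 2) 0 * v (i + 1) 0).

(* The j-th column is k x e_j; see [cross_mxP] and [cross_mx_unique]. *)
Definition cross_mx {R : realType} (k : 'cV[R]_3) : 'M[R]_3 :=
  \matrix_(i, j) crossv k (delta_mx j 0) i 0.

Definition expmx {R : realType} {n : nat} (X : 'M[R]_n.+1) : 'M[R]_n.+1 :=
  limn (series (fun i : nat => (i`!%:R : R)^-1 *: X ^+ i)).

(* The principal logarithm of a matrix Q is its logarithm whose (complex)
   eigenvalues all lie in the open strip |Im z| < pi.  For a real Q without
   eigenvalues on the closed negative real axis it exists, is unique and is
   real, so only real X are considered. *)
Definition is_principal_log {R : realType} {n : nat} (Q X : 'M[R]_n.+1) : Prop :=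
  expmx X = Q /\
  forall z : complex R, eigenvalue (map_mx (real_complex R) X) z ->
    - pi < complex.Im z < pi.

(* Junk value 0 when there is no principal logarithm. *)
Definition logmx {R : realType} {n : nat} (Q : 'M[R]_n.+1) : 'M[R]_n.+1 :=
  xget 0 [set X | is_principal_log Q X].

Definition dR {R : realType} (QA QB : 'M[R]_3) : R :=
  (Num.sqrt 2)^-1 * frobnorm (logmx (QA *m QB^T)).

Definition Cconst {R : realType} (K LA LB : 'M[R]_3) : R :=
  2 * \tr (LA ^+ 2 *m K ^+ 2 *m LB ^+ 2 - LA ^+ 2 *m K *m LB ^+ 2 *m K)
  - 4 * \tr (K *m LA *m LB *m K *m LA *m LB + K ^+ 2 *m LA ^+ 2 *m LB ^+ 2
             - K *m LA *m K *m LA *m LB ^+ 2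
             - K *m LB *m K *m LB *m LA ^+ 2).

Lemma cross_mxP (R : realType) (k x : 'cV[R]_3) : cross_mx k *m x = crossv k x.
Proof.
apply/colP => i; rewrite !mxE (eq_bigr (fun j =>
  (k (i + 1) 0 * ((j == i + 2)%:R * x j 0)
   - k (i + 2) 0 * ((j == i + 1)%:R * x j 0)))); last first.
  by move=> j _; rewrite !mxE eqxx !andbT mulrBl !mulrA
    (eq_sym j (i + 2)) (eq_sym j (i + 1)).
have pick1 (l : 'I_3) : \sum_(j < 3) (j == l)%:R * x j 0 = x l 0.
  rewrite (bigD1 l) //= eqxx mul1r big1 ?addr0 // => j /negbTE ->.
  by rewrite mul0r.
by rewrite sumrB -!mulr_sumr !pick1.
Qed.

Lemma cross_mx_unique (R : realType) (k : 'cV[R]_3) (K : 'M[R]_3) :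
  (forall x, K *m x = crossv k x) -> K = cross_mx k.
Proof.
move=> H; apply/matrixP => i j.
have := H (delta_mx j 0); rewrite -cross_mxP -!colE.
by move=> /matrixP /(_ i 0); rewrite !mxE.
Qed.

Lemma cross_mx_skew (R : realType) (k : 'cV[R]_3) :
  (cross_mx k)^T = - cross_mx k.
Proof.
apply/matrixP => -[[|[|[|//]]] Hi] -[[|[|[|//]]] Hj];
  rewrite !mxE /= ?mulr0 ?mulr1 ?subr0 ?sub0r ?opprK ?oppr0 //;
  congr (k _ 0) || (congr (- k _ 0)); exact/val_inj.
Qed.

(* Main.v *)
Require Import Defs.
From mathcomp Require Import all_boot all_order all_algebra complex.
From mathcomp Require Import all_classical all_reals all_analysis.
From mathcomp Require Import ring lra.

Set Implicit Arguments.
Unset Strict Implicit.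
Unset Printing Implicit Defensive.

Import Order.TTheory GRing.Theory Num.Theory.
Import numFieldNormedType.Exports.

Local Open Scope classical_set_scope.
Local Open Scope ring_scope.

(** Write [R = QA *m QB^T = expmx (theta *: K)].  Both distances depend on [R]
    only, and they are compared through their dependence on [theta].

    For [dR], the claim is that [theta *: K] is the principal logarithm of [R],
    so that [dR] is exactly [|theta|] ([dR_cross]).  Existence is the remark
    that the eigenvalues of [K] are [0] and [+- i].  For uniqueness, let [X] be
    a principal logarithm of [R].  If [theta != 0], then [X] commutes with [R],
    hence with [R - R^T = 2 sin theta K], hence preserves the axis [k] and acts
    on the orthogonal plane as a similarity, of logarithmic ratio [al] and
    angle [be].  Exponentiating on the axis and on the plane
    ([expmx_invariant_plane]) shows that the eigenvalue on the axis and [al]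
    vanish and that [be] and [theta] have the same sine and cosine; the strip
    condition on the eigenvalues of [X] makes them equal
    ([principal_log_cross]).  If [theta = 0] the commutation carries no
    information; instead, every complex eigenvalue of [X] has exponential [1]
    and lies in the strip, so it is [0], and [X] is nilpotent; then
    [expmx X = 1 + X + X^2 / 2 = 1] forces [X = 0] ([expmx_eq1]).

    For [dC], conjugation by [QA] turns [[A, B]] into [[LA, R LB R^T]]
    ([dC_rotation]).  By Rodrigues' formula ([expmx_cross]) and [[LA, LB] = 0]
    this is [sin theta *: [LA, [K, LB]]] plus a term of order [theta^2]
    ([commutator_rotation], [rot_remainder_le]).  Hence
    [dC^2 = sin^2 theta * |[LA, [K, LB]]|^2 + O(theta^3)].

    Since [LA] and [LB] are diagonal, the [(i, j)] entry of [[LA, [K, LB]]] is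
    [K i j] times the gaps of the two spectra at [i, j].  So its squared norm is
    a diagonal quadratic form in [k], called [gap_form] below, and expanding the
    traces in [Cconst] gives that same form ([Cconst_gap], [commutator_gap]).
    As both spectra are simple, the form is bounded below on the unit sphere by
    a positive constant depending on [LA] and [LB] only ([gap_form_lower]):
    dividing by it keeps the error uniformly of order [theta^3], and
    [sin^2 theta] differs from [theta^2] by [O(theta^3)] as well. *)

(** * The matrix exponential as a convergent series *)

Lemma mx_norm_le (R : realType) (m n : nat) (A : 'M[R]_(m, n)) (B : R) :
  0 <= B -> (forall i j, `|A i j| <= B) -> `|A| <= B.
Proof.
move=> B0 H; rewrite [leLHS]/Num.norm /= mx_normrE; apply/bigmax_leP.
by split => // -[i j] _; exact: H.
Qed.

Lemma le_mx_norm (R : realType) (m n : nat) (A : 'M[R]_(m, n)) i j :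
  `|A i j| <= `|A|.
Proof.
rewrite [leRHS]/Num.norm /= mx_normrE.
by apply: (le_bigmax _ (fun ij => `|A ij.1 ij.2|) (i, j)).
Qed.

(** The norm of a matrix is here the largest absolute value of its entries; each
    entry of the product is a sum of [n] terms, whence the factor [n]. *)
Lemma mx_normM (R : realType) (m n p : nat) (A : 'M[R]_(m, n))
    (B : 'M[R]_(n, p)) :
  `|A *m B| <= n%:R * (`|A| * `|B|).
Proof.
apply: mx_norm_le => [|i j]; first by rewrite !mulr_ge0.
rewrite mxE (le_trans (ler_norm_sum _ _ _))//.
rewrite mulr_natl -[X in _ *+ X]card_ord -sumr_const ler_sum// => l _.
by rewrite normrM ler_pM ?le_mx_norm.
Qed.

Lemma mx_normM_le (R : realType) (m n p : nat) (A : 'M[R]_(m, n))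
    (B : 'M[R]_(n, p)) (a b : R) :
  `|A| <= a -> `|B| <= b -> `|A *m B| <= n%:R * (a * b).
Proof.
by move=> hA hB; apply: le_trans (mx_normM _ _) _; rewrite ler_wpM2l// ler_pM.
Qed.

Lemma mx_normX (R : realType) (n : nat) (X : 'M[R]_n.+1) i :
  `|X ^+ i| <= (n.+1%:R * `|X|) ^+ i.
Proof.
elim: i => [|i IH].
  rewrite !expr0; apply: mx_norm_le => // i j.
  by rewrite !mxE; case: eqP => _ /=; rewrite ?normr1 ?normr0.
rewrite !exprS (le_trans (mx_normM _ _))// -mulrA ler_pM2l ?ltr0n//.
by rewrite ler_wpM2l.
Qed.

(** Reduces convergence of matrices to the scalar case, where absolute
    convergence of a series implies convergence. *)
Lemma mx_cvg (R : realType) (m n : nat) (S : nat -> 'M[R]_(m, n)) :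
  (forall i j, cvgn (fun l => S l i j)) -> cvgn S.
Proof.
move=> cS; have -> : S = (fun l => \sum_i \sum_j S l i j *: delta_mx i j).
  by apply/funext => l; rewrite [LHS]matrix_sum_delta.
apply/cvg_ex; exists (\sum_i \sum_j limn (fun l => S l i j) *: delta_mx i j).
by apply: (cvg_big add_continuous) => i _;
  apply: (cvg_big add_continuous) => j _; apply: cvgZr_tmp; exact: cS.
Qed.

Lemma expmx_cvg (R : realType) (n : nat) (X : 'M[R]_n.+1) :
  series (fun i : nat => (i`!%:R : R)^-1 *: X ^+ i) @ \oo --> expmx X.
Proof.
suff : cvgn (series (fun i : nat => (i`!%:R : R)^-1 *: X ^+ i)) by [].
apply: mx_cvg => i j.
have -> : (fun l => series (fun i => (i`!%:R)^-1 *: X ^+ i) l i j) =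
    series (fun l : nat => (l`!%:R : R)^-1 * (X ^+ l) i j).
  apply/funext => l; rewrite /series /= summxE.
  by apply: eq_bigr => k _; rewrite mxE.
apply: normed_cvg.
apply: series_le_cvg (is_cvg_series_exp_coeff (n.+1%:R * `|X|)) => l /=.
- by [].
- by rewrite /exp_coeff /= divr_ge0// exprn_ge0// mulr_ge0.
- rewrite /exp_coeff /= normrM ger0_norm ?invr_ge0// mulrC.
  rewrite ler_wpM2r ?invr_ge0//.
  by apply: le_trans (mx_normX _ _); exact: le_mx_norm.
Qed.

(** The form in which the series is used: the action of [X] on [v] determines
    the action of [expmx X] on [v]. *)
Lemma expmx_row_cvg (R : realType) (n p : nat) (X : 'M[R]_n.+1)
    (v : 'M[R]_(p, n.+1)) i j :
  series (fun l : nat => (l`!%:R : R)^-1 * (v *m X ^+ l) i j) @ \oo -->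
  (v *m expmx X) i j.
Proof.
pose S := series (fun i : nat => (i`!%:R : R)^-1 *: X ^+ i).
have -> : series (fun l : nat => (l`!%:R : R)^-1 * (v *m X ^+ l) i j) =
          (fun l => \sum_q v i q * S l q j).
  apply/funext => N; rewrite /S /series /=.
  have -> : \sum_(0 <= k < N) (k`!%:R)^-1 * (v *m X ^+ k) i j =
    (v *m \sum_(0 <= k < N) (k`!%:R)^-1 *: X ^+ k) i j.
    rewrite mulmx_sumr summxE; apply: eq_bigr => k _.
    by rewrite -scalemxAr [RHS]mxE.
  by rewrite mxE.
rewrite mxE; apply: (cvg_big add_continuous) => q _; apply: cvgMl_tmp.
apply: (cvg_comp S (fun M : 'M[R]_n.+1 => M q j) (@expmx_cvg R n X)).
exact: coord_continuous.
Qed.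

Lemma expmx_comm (R : realType) (n : nat) (X Y : 'M[R]_n.+1) :
  X *m Y = Y *m X -> expmx X *m Y = Y *m expmx X.
Proof.
move=> XY; apply/matrixP => i j.
have XlY l : X ^+ l *m Y = Y *m X ^+ l.
  elim: l => [|l IH]; first by rewrite expr0 mulmx1 mul1mx.
  by rewrite exprSr -[_ * X]/(_ *m X) -mulmxA XY !mulmxA IH.
have := @expmx_row_cvg _ _ _ X Y i j.
have -> : series (fun l : nat => (l`!%:R : R)^-1 * (Y *m X ^+ l) i j) =
    (fun N => \sum_q series (fun l => (l`!%:R : R)^-1 * (1%:M *m X ^+ l) i q) N
                     * Y q j).
  apply/funext => N; rewrite /series /=.
  under [RHS]eq_bigr do rewrite mulr_suml.
  rewrite exchange_big; apply: eq_bigr => l _ /=.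
  rewrite -XlY mxE mulr_sumr; apply: eq_bigr => q _.
  by rewrite mul1mx mulrA.
move=> cY; apply/esym; apply: (cvg_unique _ cY) => //.
rewrite mxE; apply: (cvg_big add_continuous) => q _; apply: cvgMr_tmp.
by have := @expmx_row_cvg _ _ _ X 1%:M i q; rewrite [_ *m expmx X]mul1mx.
Qed.

Lemma expmx_nilpotent3 (R : realType) (n : nat) (X : 'M[R]_n.+1) :
  X ^+ 3 = 0 -> expmx X = 1 + X + 2^-1 *: X ^+ 2.
Proof.
move=> X3; apply: lim_near_cst; first exact: norm_hausdorff.
near=> m; have -> : m = (m - 3 + 3)%N by rewrite subnK//; near: m; exists 3%N.
rewrite /series /= addnC big_mkord big_split_ord /= [X in _ + X]big1 => [|i _].
  rewrite !big_ord_recl big_ord0 /= !addr0 expr0 expr1 fact0 invr1 !scale1r.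
  by rewrite addrA.
by rewrite exprD X3 mul0r scaler0.
Unshelve. all: by end_near. Qed.

Lemma expmx0 (R : realType) (n : nat) : expmx (0 : 'M[R]_n.+1) = 1.
Proof. by rewrite expmx_nilpotent3 ?expr0n // scaler0 !addr0. Qed.

(** * The matrix exponential on an invariant plane *)

Lemma Re_mul (R : realType) (z w : complex R) :
  complex.Re (z * w) =
    complex.Re z * complex.Re w - complex.Im z * complex.Im w.
Proof. by case: z w => [a b] [c d]. Qed.

Lemma Im_mul (R : realType) (z w : complex R) :
  complex.Im (z * w) =
    complex.Re z * complex.Im w + complex.Im z * complex.Re w.
Proof. by case: z w => [a b] [c d]. Qed.

(** Geometric growth makes the series of [exp (t z)] converge everywhere.  The
    sum of absolute values is submultiplicative like the modulus, without its
    square root. *)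
Lemma norm_ReIm_exprn_le (R : realType) (z : complex R) (n : nat)
    (B := `|complex.Re z| + `|complex.Im z|) :
  `|complex.Re (z ^+ n)| + `|complex.Im (z ^+ n)| <= B ^+ n.
Proof.
elim: n => [|n IH]; first by rewrite !expr0 /= normr1 normr0 addr0.
rewrite !exprS Re_mul Im_mul.
apply: (@le_trans _ _ (B * (`|complex.Re (z ^+ n)| + `|complex.Im (z ^+ n)|))).
  rewrite /B; set x := complex.Re (z ^+ n); set y := complex.Im (z ^+ n).
  have := ler_normB (complex.Re z * x) (complex.Im z * y).
  have := ler_normD (complex.Re z * y) (complex.Im z * x).
  rewrite !normrM; nra.
by rewrite ler_wpM2l// addr_ge0.
Qed.

Lemma pseries_entire_cvg (R : realType) (f : R^nat) (B x : R) :
  0 <= B -> (forall n, `|f n| <= B ^+ n / n`!%:R) -> cvgn (pseries f x).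
Proof.
move=> B0 fB; apply: normed_cvg.
apply: series_le_cvg (is_cvg_series_exp_coeff (B * `|x|)) => i //=.
  by rewrite /exp_coeff /= divr_ge0// exprn_ge0// mulr_ge0.
by rewrite /exp_coeff /= normrM normrX exprMn mulrAC ler_wpM2r// exprn_ge0.
Qed.

Lemma pseries_diffs_fact (R : realType) (f : R^nat) :
  pseries_diffs (fun n => f n / n`!%:R) = (fun n => f n.+1 / n`!%:R).
Proof.
apply/funext => n; rewrite /pseries_diffs factS natrM.
by rewrite invfM mulrCA mulVKf// pnatr_eq0.
Qed.

Lemma pseries_lincomb (R : realType) (f g : R^nat) (a b x : R) :
  cvgn (pseries f x) -> cvgn (pseries g x) ->
  pseries (fun n => a * f n + b * g n) x @ \oo -->
    a * limn (pseries f x) + b * limn (pseries g x).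
Proof.
move=> cf cg.
have -> : pseries (fun n => a * f n + b * g n) x =
   (fun n => a * pseries f x n + b * pseries g x n).
  apply/funext => n; rewrite /pseries /series /= !mulr_sumr -big_split /=.
  by apply: eq_bigr => i _; ring.
by apply: cvgD; apply: cvgMl_tmp.
Qed.

(** Real and imaginary parts of the Taylor coefficients of [t |-> exp (t z)]. *)
Definition re_exp_coef (R : realType) (z : complex R) : R^nat :=
  fun n => complex.Re (z ^+ n) / n`!%:R.

Definition im_exp_coef (R : realType) (z : complex R) : R^nat :=
  fun n => complex.Im (z ^+ n) / n`!%:R.

Lemma re_exp_coef_diffs (R : realType) (z : complex R) :
  pseries_diffs (re_exp_coef z) = (fun n =>
    complex.Re z * re_exp_coef z n - complex.Im z * im_exp_coef z n).
Proof.
rewrite pseries_diffs_fact; apply/funext => n.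
by rewrite exprS Re_mul /re_exp_coef /im_exp_coef; ring.
Qed.

Lemma im_exp_coef_diffs (R : realType) (z : complex R) :
  pseries_diffs (im_exp_coef z) = (fun n =>
    complex.Re z * im_exp_coef z n + complex.Im z * re_exp_coef z n).
Proof.
rewrite pseries_diffs_fact; apply/funext => n.
by rewrite exprS Im_mul /re_exp_coef /im_exp_coef; ring.
Qed.

Lemma re_exp_cvg (R : realType) (z : complex R) (x : R) :
  cvgn (pseries (re_exp_coef z) x).
Proof.
apply: (@pseries_entire_cvg _ _ (`|complex.Re z| + `|complex.Im z|)) => [|n].
  by rewrite addr_ge0.
rewrite /re_exp_coef normrM [`|_^-1|]ger0_norm ?invr_ge0// ler_wpM2r
  ?invr_ge0//.
by apply: le_trans (norm_ReIm_exprn_le z n); rewrite lerDl.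
Qed.

Lemma im_exp_cvg (R : realType) (z : complex R) (x : R) :
  cvgn (pseries (im_exp_coef z) x).
Proof.
apply: (@pseries_entire_cvg _ _ (`|complex.Re z| + `|complex.Im z|)) => [|n].
  by rewrite addr_ge0.
rewrite /im_exp_coef normrM [`|_^-1|]ger0_norm ?invr_ge0// ler_wpM2r
  ?invr_ge0//.
by apply: le_trans (norm_ReIm_exprn_le z n); rewrite lerDr.
Qed.

Definition re_exp (R : realType) (z : complex R) (t : R) :=
  limn (pseries (re_exp_coef z) t).

Definition im_exp (R : realType) (z : complex R) (t : R) :=
  limn (pseries (im_exp_coef z) t).

(** The pair is the solution of the differential equation [f' = z f], split into
    real and imaginary parts. *)
Lemma re_im_exp_derive (R : realType) (z : complex R) (t : R) :
  is_derive t 1 (re_exp z)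
    (complex.Re z * re_exp z t - complex.Im z * im_exp z t) /\
  is_derive t 1 (im_exp z)
    (complex.Re z * im_exp z t + complex.Im z * re_exp z t).
Proof.
have lin (a b x : R) :
    cvgn (pseries (fun n => a * re_exp_coef z n + b * im_exp_coef z n) x).
  apply: cvgP; apply: pseries_lincomb; [exact: re_exp_cvg|exact: im_exp_cvg].
have dre : pseries_diffs (re_exp_coef z) = (fun n =>
    complex.Re z * re_exp_coef z n + (- complex.Im z) * im_exp_coef z n).
  by rewrite re_exp_coef_diffs; apply/funext => n; ring.
have dim : pseries_diffs (im_exp_coef z) = (fun n =>
    complex.Im z * re_exp_coef z n + complex.Re z * im_exp_coef z n).
  by rewrite im_exp_coef_diffs; apply/funext => n; ring.
have dlin a b :
    pseries_diffs (fun n => a * re_exp_coef z n + b * im_exp_coef z n) =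
    (fun n => (a * complex.Re z + b * complex.Im z) * re_exp_coef z n
     + (b * complex.Re z - a * complex.Im z) * im_exp_coef z n).
  apply/funext => n.
  have := congr1 (fun f => f n) dre; have := congr1 (fun f => f n) dim.
  rewrite /pseries_diffs /= => h1 h2.
  by rewrite mulrDr (mulrCA _ a) (mulrCA _ b) h1 h2; ring.
have tlt : `|t| < `| `|t| + 1| by rewrite [ltRHS]ger0_norm// addrC -subr_gt0
  addrK.
have key (c : R^nat) (a b : R) :
    (forall x, cvgn (pseries c x)) ->
    pseries_diffs c = (fun n => a * re_exp_coef z n + b * im_exp_coef z n) ->
    is_derive t 1 (fun x => limn (pseries c x))
      (a * re_exp z t + b * im_exp z t).
  move=> cc dc.
  have -> : a * re_exp z t + b * im_exp z t =
      limn (pseries (pseries_diffs c) t).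
    rewrite dc; apply/esym/cvg_lim => //.
    by apply: pseries_lincomb; [exact: re_exp_cvg|exact: im_exp_cvg].
  apply: (@pseries_snd_diffs _ _ (`|t| + 1)) => //; rewrite dc ?dlin;
    exact: lin.
split.
  rewrite -mulNr; apply: key => //; exact: re_exp_cvg.
rewrite addrC; apply: key => //; exact: im_exp_cvg.
Qed.

Lemma re_im_exp0 (R : realType) (z : complex R) :
  re_exp z 0 = 1 /\ im_exp z 0 = 0.
Proof.
have H (f : R^nat) : limn (pseries f 0) = f 0%N.
  apply: lim_near_cst => //; near=> m; rewrite -[m]prednK; last by near: m.
  rewrite /pseries /series /= big_nat_recl// expr0 mulr1 big1 ?addr0// => i _.
  by rewrite expr0n mulr0.
by rewrite /re_exp /im_exp !H /re_exp_coef /im_exp_coef /= divr1 mul0r.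
Unshelve. all: by end_near. Qed.

(** Multiplying [re_exp z + i im_exp z] by the inverse of the expected value
    [exp (t z)] gives a function with zero derivative, hence constant. *)
Lemma re_im_expE (R : realType) (z : complex R) (t : R) :
  re_exp z t = expR (complex.Re z * t) * cos (complex.Im z * t) /\
  im_exp z t = expR (complex.Re z * t) * sin (complex.Im z * t).
Proof.
set a := complex.Re z; set b := complex.Im z.
pose E x : R := expR (- a * x); pose C x : R := cos (b * x).
pose S x : R := sin (b * x).
have dl c (x : R) : is_derive x 1 ( *%R c) c.
  by apply: is_derive_eq; rewrite /GRing.scale /= mulr1.
have dE (x : R) : is_derive x 1 E (E x * - a) by apply: is_derive1_comp.
have dC (x : R) : is_derive x 1 C (- S x * b) by apply: is_derive1_comp.
have dS (x : R) : is_derive x 1 S (C x * b) by apply: is_derive1_comp.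
pose U x := E x * (C x * re_exp z x + S x * im_exp z x).
pose V x := E x * (C x * im_exp z x - S x * re_exp z x).
have dre (x : R) := (re_im_exp_derive z x).1.
have dim (x : R) := (re_im_exp_derive z x).2.
have [re0 im0] := re_im_exp0 z.
have U1 : U t = 1.
  have -> : U t = U 0.
    apply: is_derive_0_is_cst => x; rewrite /U.
    apply: is_derive_eq; rewrite /GRing.scale /= -/a -/b; ring.
  by rewrite /U /E /C /S re0 im0 !mulr0 expR0 cos0; ring.
have V0 : V t = 0.
  have -> : V t = V 0.
    apply: is_derive_0_is_cst => x; rewrite /V.
    apply: is_derive_eq; rewrite /GRing.scale /= -/a -/b; ring.
  by rewrite /V /C /S re0 im0 !mulr0 sin0; ring.
have EE : expR (a * t) * E t = 1 by rewrite /E mulNr expRxMexpNx_1.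
have CS := cos2Dsin2 (b * t).
rewrite -/(C t) -/(S t) in CS *.
split.
- transitivity (expR (a * t) * (C t * U t - S t * V t)); last first.
    by rewrite U1 V0; ring.
  transitivity ((expR (a * t) * E t) * (C t ^+ 2 + S t ^+ 2) * re_exp z t).
    by rewrite EE CS !mul1r.
  by rewrite /U /V; ring.
- transitivity (expR (a * t) * (S t * U t + C t * V t)); last first.
    by rewrite U1 V0; ring.
  transitivity ((expR (a * t) * E t) * (C t ^+ 2 + S t ^+ 2) * im_exp z t).
    by rewrite EE CS !mul1r.
  by rewrite /U /V; ring.
Qed.

(** The rows [v] and [w] span a space on which [X] acts as the complex number
    [z = a + i b]: with [v + i w] as the eigenvector, [X ^+ l] acts as [z ^+ l].
    So [expmx X] acts as [exp z].  This one statement gives Rodrigues' formula,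
    the equations satisfied by a logarithm of a rotation, and the action of
    [expmx X] on complex eigenvectors. *)
Lemma expmx_invariant_plane (R : realType) (n p : nat) (X : 'M[R]_n.+1)
    (v w : 'M[R]_(p, n.+1)) (a b : R) :
  v *m X = a *: v - b *: w -> w *m X = b *: v + a *: w ->
  v *m expmx X = (expR a * cos b) *: v - (expR a * sin b) *: w /\
  w *m expmx X = (expR a * sin b) *: v + (expR a * cos b) *: w.
Proof.
move=> vX wX; pose z : complex R := Complex a b.
have pow l :
    v *m X ^+ l = complex.Re (z ^+ l) *: v - complex.Im (z ^+ l) *: w /\
    w *m X ^+ l = complex.Im (z ^+ l) *: v + complex.Re (z ^+ l) *: w.
  elim: l => [|l [IHv IHw]].
    by rewrite !expr0 /= !scale1r !scale0r subr0 add0r !mulmx1.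
  rewrite !exprSr !mulmxA IHv IHw mulmxBl mulmxDl -!scalemxAl vX wX Re_mul
    Im_mul /=.
  by split; apply/matrixP => i j; rewrite !mxE; ring.
have [rE iE] := re_im_expE z 1; rewrite !mulr1 /= in rE iE.
have comb (x y : R) (u : 'M[R]_(p, n.+1)) i j :
    (forall l, (u *m X ^+ l) i j =
       x * complex.Re (z ^+ l) + y * complex.Im (z ^+ l)) ->
    (u *m expmx X) i j = x * (expR a * cos b) + y * (expR a * sin b).
  move=> uX; rewrite -rE -iE.
  have := @pseries_lincomb _ _ _ x y _ (@re_exp_cvg _ z 1) (@im_exp_cvg _ z 1).
  have := @expmx_row_cvg _ _ _ X u i j.
  have -> : series (fun l => (l`!%:R)^-1 * (u *m X ^+ l) i j) =
     pseries (fun n => x * re_exp_coef z n + y * im_exp_coef z n) 1.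
    apply/funext => N; rewrite /pseries /series /=; apply: eq_bigr => l _.
    by rewrite uX expr1n /re_exp_coef /im_exp_coef; ring.
  by move=> c1 c2; apply: cvg_unique c1 c2.
split; apply/matrixP => i j.
  rewrite (comb (v i j) (- w i j)) => [|l]; first by rewrite !mxE; ring.
  by rewrite (pow l).1 !mxE; ring.
rewrite (comb (w i j) (v i j)) => [|l]; first by rewrite !mxE; ring.
by rewrite (pow l).2 !mxE; ring.
Qed.

(** * Complex eigenvalues of real matrices *)

Lemma Re_sum (R : realType) (I : finType) (F : I -> complex R) :
  complex.Re (\sum_i F i) = \sum_i complex.Re (F i).
Proof. by apply: (big_morph (@complex.Re R)) => // -[? ?] [? ?]. Qed.

Lemma Im_sum (R : realType) (I : finType) (F : I -> complex R) :
  complex.Im (\sum_i F i) = \sum_i complex.Im (F i).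
Proof. by apply: (big_morph (@complex.Im R)) => // -[? ?] [? ?]. Qed.

Lemma Re_mulmx_real (R : realType) (n : nat) (v : 'rV[complex R]_n)
    (X : 'M[R]_n) j :
  complex.Re ((v *m map_mx (real_complex R) X) 0 j) =
  (map_mx (@complex.Re R) v *m X) 0 j.
Proof.
rewrite !mxE Re_sum; apply: eq_bigr => i _.
by rewrite !mxE Re_mul /= mulr0 subr0.
Qed.

Lemma Im_mulmx_real (R : realType) (n : nat) (v : 'rV[complex R]_n)
    (X : 'M[R]_n) j :
  complex.Im ((v *m map_mx (real_complex R) X) 0 j) =
  (map_mx (@complex.Im R) v *m X) 0 j.
Proof.
rewrite !mxE Im_sum; apply: eq_bigr => i _.
by rewrite !mxE Im_mul /= mulr0 add0r.
Qed.

(** Separates an eigenvector [u + i w] into real and imaginary parts, which puts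
    it in the form that [expmx_invariant_plane] expects. *)
Lemma complex_eigenvalueP (R : realType) (n : nat) (X : 'M[R]_n)
    (z : complex R) :
  eigenvalue (map_mx (real_complex R) X) z <->
  exists u w : 'rV[R]_n, [/\ u *m X = complex.Re z *: u - complex.Im z *: w,
    w *m X = complex.Im z *: u + complex.Re z *: w & u != 0 \/ w != 0].
Proof.
split=> [/eigenvalueP[v vX v0]|[u [w [uX wX uw0]]]].
  exists (map_mx (@complex.Re R) v), (map_mx (@complex.Im R) v); split.
  - by apply/rowP => j; rewrite -Re_mulmx_real vX !mxE Re_mul.
  - by apply/rowP => j; rewrite -Im_mulmx_real vX !mxE Im_mul addrC.
  - apply/orP; apply: contraNT v0.
    rewrite negb_or !negbK => /andP[/eqP u0 /eqP w0].
    apply/eqP/rowP => j; move/rowP/(_ j) : u0; move/rowP/(_ j) : w0.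
    by rewrite !mxE; case: (v 0 j) => a b /= -> ->.
pose v := \row_j Complex (u 0 j) (w 0 j).
have vu : map_mx (@complex.Re R) v = u by apply/rowP => j; rewrite !mxE.
have vw : map_mx (@complex.Im R) v = w by apply/rowP => j; rewrite !mxE.
apply/eigenvalueP; exists v.
  apply/rowP => j; apply/eqP; rewrite eq_complex Re_mulmx_real Im_mulmx_real.
  by rewrite vu vw uX wX !mxE Re_mul Im_mul /= addrC [X in _ && (X == _)]addrC
    !eqxx.
case: uw0; apply: contra_neq => v0; first by rewrite -vu v0 map_mx0.
by rewrite -vw v0; apply/rowP => j; rewrite !mxE.
Qed.

(** * Explicit matrices of size three *)

(** A matrix given by its rows, so that products, transposes and traces of
    explicit matrices reduce to explicit scalars on which [ring] concludes. *)
Definition mx3 (R : realType) (s : seq (seq R)) : 'M[R]_3 :=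
  \matrix_(i, j) nth 0 (nth [::] s i) j.

Lemma mx3_mul (R : realType)
    (a b c d e f g h i a' b' c' d' e' f' g' h' i' : R) :
  mx3 [:: [:: a; b; c]; [:: d; e; f]; [:: g; h; i]] *m
  mx3 [:: [:: a'; b'; c']; [:: d'; e'; f']; [:: g'; h'; i']] =
  mx3 [:: [:: a * a' + b * d' + c * g'; a * b' + b * e' + c * h';
              a * c' + b * f' + c * i'];
          [:: d * a' + e * d' + f * g'; d * b' + e * e' + f * h';
              d * c' + e * f' + f * i'];
          [:: g * a' + h * d' + i * g'; g * b' + h * e' + i * h';
              g * c' + h * f' + i * i']].
Proof.
apply/matrixP => -[[|[|[|//]]] Hi] -[[|[|[|//]]] Hj];
  by rewrite !mxE !big_ord_recl big_ord0 !mxE /=; ring.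
Qed.

Lemma mx3_sub (R : realType)
    (a b c d e f g h i a' b' c' d' e' f' g' h' i' : R) :
  mx3 [:: [:: a; b; c]; [:: d; e; f]; [:: g; h; i]] -
  mx3 [:: [:: a'; b'; c']; [:: d'; e'; f']; [:: g'; h'; i']] =
  mx3 [:: [:: a - a'; b - b'; c - c']; [:: d - d'; e - e'; f - f'];
          [:: g - g'; h - h'; i - i']].
Proof.
by apply/matrixP => -[[|[|[|//]]] Hi] -[[|[|[|//]]] Hj]; rewrite !mxE.
Qed.

Lemma mx3_add (R : realType)
    (a b c d e f g h i a' b' c' d' e' f' g' h' i' : R) :
  mx3 [:: [:: a; b; c]; [:: d; e; f]; [:: g; h; i]] +
  mx3 [:: [:: a'; b'; c']; [:: d'; e'; f']; [:: g'; h'; i']] =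
  mx3 [:: [:: a + a'; b + b'; c + c']; [:: d + d'; e + e'; f + f'];
          [:: g + g'; h + h'; i + i']].
Proof.
by apply/matrixP => -[[|[|[|//]]] Hi] -[[|[|[|//]]] Hj]; rewrite !mxE.
Qed.

Lemma mx3_trmx (R : realType) (a b c d e f g h i : R) :
  (mx3 [:: [:: a; b; c]; [:: d; e; f]; [:: g; h; i]])^T =
  mx3 [:: [:: a; d; g]; [:: b; e; h]; [:: c; f; i]].
Proof.
by apply/matrixP => -[[|[|[|//]]] Hi] -[[|[|[|//]]] Hj]; rewrite !mxE.
Qed.

Lemma mxtrace3 (R : realType) (A : 'M[R]_3) : \tr A = A 0 0 + A 1 1 + A 2 2.
Proof.
rewrite /mxtrace !big_ord_recl big_ord0 addr0 addrA.
by congr (A _ _ + A _ _ + A _ _); exact/val_inj.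
Qed.

Lemma mx3_tr (R : realType) (a b c d e f g h i : R) :
  \tr (mx3 [:: [:: a; b; c]; [:: d; e; f]; [:: g; h; i]]) = a + e + i.
Proof. by rewrite mxtrace3 !mxE. Qed.

Lemma diag_mx3 (R : realType) (l : 'rV[R]_3) :
  diag_mx l = mx3 [:: [:: l 0 0; 0; 0]; [:: 0; l 0 1; 0]; [:: 0; 0; l 0 2]].
Proof.
apply/matrixP => -[[|[|[|//]]] Hi] -[[|[|[|//]]] Hj];
  rewrite !mxE -val_eqE /= ?mulr0n//;
  rewrite mulr1n; congr (l _ _); exact/val_inj.
Qed.

Lemma col_outer (R : realType) (k : 'cV[R]_3)
    (x := k 0 0) (y := k 1 0) (z := k 2 0) :
  k *m k^T = mx3 [:: [:: x * x; x * y; x * z]; [:: y * x; y * y; y * z];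
                     [:: z * x; z * y; z * z]].
Proof.
apply/matrixP => -[[|[|[|//]]] Hi] -[[|[|[|//]]] Hj];
  rewrite !mxE big_ord1 !mxE /=; congr (k _ _ * k _ _); exact/val_inj.
Qed.

Definition row3 (R : realType) (s : seq R) : 'rV[R]_3 := \row_j nth 0 s j.

Lemma row3E (R : realType) (q : 'rV[R]_3) : q = row3 [:: q 0 0; q 0 1; q 0 2].
Proof.
apply/rowP => -[[|[|[|//]]] Hj]; rewrite mxE /=; congr (q _ _); exact/val_inj.
Qed.

Lemma row3_mul (R : realType) (x y z a b c d e f g h i : R) :
  row3 [:: x; y; z] *m mx3 [:: [:: a; b; c]; [:: d; e; f]; [:: g; h; i]] =
  row3 [:: x * a + y * d + z * g; x * b + y * e + z * h; x * c + y * f + z * i].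
Proof.
apply/rowP => -[[|[|[|//]]] Hj]; by rewrite !mxE !big_ord_recl big_ord0 !mxE
  /=; ring.
Qed.

Lemma row3_norm (R : realType) (x y z : R) :
  (row3 [:: x; y; z] *m (row3 [:: x; y; z])^T) 0 0 = x * x + y * y + z * z.
Proof. by rewrite !mxE !big_ord_recl big_ord0 !mxE /=; ring. Qed.

(** * Cross-product matrices and Rodrigues' formula *)

Lemma unit_colP (R : realType) (k : 'cV[R]_3) :
  frobnorm k = 1 -> k 0 0 ^+ 2 + k 1 0 ^+ 2 + k 2 0 ^+ 2 = 1.
Proof.
rewrite /frobnorm col_outer mxtrace3 !mxE /= -!expr2 => h.
rewrite -[LHS]sqr_sqrtr ?h ?expr1n// !addr_ge0 ?sqr_ge0//.
Qed.

Lemma cross_mxE (R : realType) (k : 'cV[R]_3)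
    (x := k 0 0) (y := k 1 0) (z := k 2 0) :
  cross_mx k = mx3 [:: [:: 0; - z; y]; [:: z; 0; - x]; [:: - y; x; 0]].
Proof.
apply/matrixP => -[[|[|[|//]]] Hi] -[[|[|[|//]]] Hj];
  rewrite !mxE /= ?mulr0 ?mulr1 ?subr0 ?sub0r ?opprK ?oppr0 //;
  congr (k _ 0) || (congr (- k _ 0)); exact/val_inj.
Qed.

(** This is [k x (k x v) = (k . v) k - v] for a unit vector [k]: up to sign,
    [K^2] is the orthogonal projection on the plane orthogonal to [k]. *)
Lemma cross_mx_sqr (R : realType) (k : 'cV[R]_3) : frobnorm k = 1 ->
  cross_mx k *m cross_mx k = k *m k^T - 1%:M.
Proof.
move=> /unit_colP; rewrite cross_mxE col_outer mx3_mul => k1.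
apply/matrixP => -[[|[|[|//]]] Hi] -[[|[|[|//]]] Hj];
  rewrite !mxE -?val_eqE /=; lra.
Qed.

Lemma row_cross_mx (R : realType) (k : 'cV[R]_3) : k^T *m cross_mx k = 0.
Proof.
apply: trmx_inj; rewrite trmx_mul trmx0 cross_mx_skew trmxK mulNmx cross_mxP.
apply/colP => i; rewrite !mxE mulrC subrr oppr0 //.
Qed.

Lemma cross_mx_col (R : realType) (k : 'cV[R]_3) : cross_mx k *m k = 0.
Proof. by rewrite cross_mxP; apply/colP => i; rewrite !mxE mulrC subrr. Qed.

Lemma cross_mx_cube (R : realType) (k : 'cV[R]_3) : frobnorm k = 1 ->
  cross_mx k *m cross_mx k *m cross_mx k = - cross_mx k.
Proof.
move=> k1; rewrite cross_mx_sqr// mulmxBl -mulmxA row_cross_mx mulmx0 mul1mx.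
by rewrite sub0r.
Qed.

Lemma tr_cross_mx_trmx (R : realType) (k : 'cV[R]_3) : frobnorm k = 1 ->
  \tr (cross_mx k *m (cross_mx k)^T) = 2.
Proof.
move=> k1; rewrite cross_mx_skew mulmxN cross_mx_sqr// col_outer mxtrace3.
move/unit_colP : k1; rewrite !mxE /=; lra.
Qed.

Lemma norm_cross_mx_le1 (R : realType) (k : 'cV[R]_3) :
  frobnorm k = 1 -> `|cross_mx k| <= 1.
Proof.
move=> /unit_colP k1.
have hx : `|k 0 0| <= 1 by rewrite ler_norml; nra.
have hy : `|k 1 0| <= 1 by rewrite ler_norml; nra.
have hz : `|k 2 0| <= 1 by rewrite ler_norml; nra.
apply: mx_norm_le => // i j; rewrite cross_mxE.
by case: i => -[|[|[|//]]] Hi; case: j => -[|[|[|//]]] Hj;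
  rewrite !mxE /= ?normrN ?normr0.
Qed.

(** Rows of the form [q *m K] are those orthogonal to [k]; [u] and [u *m K] are
    then orthogonal of the same length, so they resolve the projection on that
    plane. *)
Lemma plane_frame (R : realType) (k : 'cV[R]_3) (q : 'rV[R]_3)
    (K := cross_mx k) (u := q *m K) (w := u *m K) : frobnorm k = 1 ->
  u^T *m u + w^T *m w = (u *m u^T) 0 0 *: (1%:M - k *m k^T).
Proof.
(* The factor |k|^2 = tr (k k^T) makes the identity homogeneous in k; in that
   form it is polynomial and holds for every k. *)
move=> k1; suff : \tr (k *m k^T) *: (u^T *m u) + w^T *m w =
    (u *m u^T) 0 0 *: (\tr (k *m k^T) *: 1%:M - k *m k^T).
  have -> : \tr (k *m k^T) = 1.
    by rewrite col_outer mxtrace3 !mxE /= -!expr2 unit_colP.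
  by rewrite !scale1r.
rewrite /w /u [q]row3E /K cross_mxE !row3_mul row3_norm col_outer mxtrace3 !mxE
  /=.
apply/matrixP => -[[|[|[|//]]] Hi] -[[|[|[|//]]] Hj];
  rewrite !mxE !big_ord1 !mxE -?val_eqE /=; ring.
Qed.

(** Rodrigues' formula.  [K] rotates [K] and [- K^2] into each other, and kills
    the row [k^T]; the identity is [k *m k^T - K^2], so the three values of the
    exponential add up. *)
Lemma expmx_cross (R : realType) (k : 'cV[R]_3) (t : R) : frobnorm k = 1 ->
  expmx (t *: cross_mx k) = 1%:M + sin t *: cross_mx k
    + (1 - cos t) *: (cross_mx k *m cross_mx k).
Proof.
move=> k1; set K := cross_mx k.
have [KQ KKQ] :
    K *m expmx (t *: K) =
      (expR 0 * cos t) *: K - (expR 0 * sin t) *: - (K *m K) /\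
    - (K *m K) *m expmx (t *: K) =
      (expR 0 * sin t) *: K + (expR 0 * cos t) *: - (K *m K).
  apply: expmx_invariant_plane.
    by rewrite -scalemxAr scale0r sub0r scalerN opprK.
  by rewrite -scalemxAr mulNmx cross_mx_cube// opprK scale0r addr0.
have [rQ _] :
    k^T *m expmx (t *: K) =
      (expR 0 * cos 0) *: k^T - (expR 0 * sin 0) *: 0 /\
    (0 : 'rV_3) *m expmx (t *: K) =
      (expR 0 * sin 0) *: k^T + (expR 0 * cos 0) *: 0.
  apply: expmx_invariant_plane.
    by rewrite -scalemxAr row_cross_mx !scaler0 scale0r subr0.
  by rewrite mul0mx scaler0 scale0r addr0.
rewrite !expR0 !mul1r cos0 scale1r scaler0 subr0 in rQ KQ KKQ.
have I : 1%:M = k *m k^T - K *m K.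
  by rewrite cross_mx_sqr// opprB addrC subrK.
rewrite -[LHS]mul1mx I mulmxDl -mulmxA rQ KKQ.
have -> : k *m k^T = 1%:M + K *m K by rewrite I subrK.
by apply/matrixP => i j; rewrite !mxE; ring.
Qed.

(** * The principal logarithm of a rotation *)

Lemma sin_neq0 (R : realType) (t : R) : - pi < t < pi -> t != 0 -> sin t != 0.
Proof.
move=> /andP[t1 t2]; case: ltgtP => // t0 _.
  by rewrite -oppr_eq0 -sinN gt_eqF// sin_gt0_pi// oppr_gt0 t0 ltrNl.
by rewrite gt_eqF// sin_gt0_pi// t0.
Qed.

(** The cosine determines the angle up to sign, and the sine, nonzero unless the
    angle is zero, fixes the sign. *)
Lemma cos_sin_inj (R : realType) (x y : R) : - pi < x < pi -> - pi < y < pi ->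
  cos x = cos y -> sin x = sin y -> x = y.
Proof.
move=> xpi ypi cxy sxy.
have inpi (z : R) : - pi < z < pi -> `|z| \in `[0, pi].
  by rewrite in_itv /= normr_ge0 -ltr_norml => /ltW.
have : `|x| = `|y| by apply: cos_inj; rewrite ?cos_norm ?inpi.
move/eqP; rewrite eqr_norm2 => /orP[]/eqP // xNy.
have [y0|/(sin_neq0 ypi)] := eqVneq y 0; first by rewrite xNy y0 oppr0.
by move: sxy; rewrite xNy sinN => /eqP; rewrite eqNr => ->.
Qed.

(** Every complex eigenvalue of [X] has exponential [1], so the strip condition
    leaves only [0]; [X] is then nilpotent by the Cayley-Hamilton theorem, and
    the exponential is a polynomial in [X] whose nonconstant part is [X] times a
    unit. *)
Lemma expmx_eq1 (R : realType) (X : 'M[R]_3) :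
  expmx X = 1%:M ->
  (forall z : complex R, eigenvalue (map_mx (real_complex R) X) z ->
    - pi < complex.Im z < pi) -> X = 0.
Proof.
move=> X1 strip.
have ev0 z : eigenvalue (map_mx (real_complex R) X) z -> z = 0.
  move=> zX; have zpi := strip z zX.
  have [u [w [uX wX uw0]]] := (complex_eigenvalueP X z).1 zX.
  have [] := expmx_invariant_plane uX wX.
  rewrite X1 !mulmx1; set a := complex.Re z in uX wX *;
    set b := complex.Im z in uX wX zpi *.
  set c := expR a * cos b; set s := expR a * sin b => hu hw.
  (* The pair (u, w) is fixed by the multiplication by c + i s, so
     |c + i s - 1|^2 kills both u and w. *)
  have : (c - 1) ^+ 2 + s ^+ 2 = 0.
    apply/eqP; have [|] := uw0 => /eqP nz.
      case: eqP => // /eqP nz'; case: nz.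
      apply: (scalerI nz'); rewrite scaler0.
      transitivity ((c - 1) *: ((c *: u - s *: w) - u)
                    + s *: ((s *: u + c *: w) - w)).
        by apply/rowP => j; rewrite !mxE; ring.
      by rewrite -hu -hw !subrr !scaler0 addr0.
    case: eqP => // /eqP nz'; case: nz.
    apply: (scalerI nz'); rewrite scaler0.
    transitivity ((c - 1) *: ((s *: u + c *: w) - w)
                  - s *: ((c *: u - s *: w) - u)).
      by apply/rowP => j; rewrite !mxE; ring.
    by rewrite -hu -hw !subrr !scaler0 subr0.
  move/eqP; rewrite paddr_eq0 ?sqr_ge0// !sqrf_eq0 subr_eq0.
  move=> /andP[/eqP c1 /eqP s0].
  have sb : sin b = 0.
    by move/eqP: s0; rewrite /s mulf_eq0 expR_eq0 => /eqP.
  have cb : cos b = 1.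
    have := cos2Dsin2 b; rewrite sb expr0n addr0 /= => /eqP; rewrite sqrf_eq1.
    case/orP => /eqP // cN; move: c1; rewrite /c cN mulrN1 => e.
    by have := expR_gt0 a; rewrite -oppr_lt0 e ltr10.
  have b0 : b = 0.
    by apply: cos_sin_inj; rewrite ?cos0 ?sin0// oppr_lt0 pi_gt0.
  have a0 : a = 0 by apply: expR_inj; rewrite expR0; move: c1;
    rewrite /c cb mulr1.
  by rewrite /a /b in a0 b0; case: z a0 b0 {zX zpi uX wX a b c s hu hw c1 s0 sb
    cb} => a b /= -> ->.
have X3 : X ^+ 3 = 0.
  pose Y := map_mx (real_complex R) X.
  have [r rE] := closed_field_poly_normal (char_poly Y).
  rewrite (monicP (char_poly_monic Y)) scale1r in rE.
  have r0 z : z \in r -> z = 0.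
    move=> zr; apply: ev0; rewrite eigenvalue_root_char rE root_prod_XsubC //.
  have sr : size r = 3%N.
    by have := size_char_poly Y; rewrite rE size_prod_XsubC => -[].
  have cX : char_poly Y = 'X^3.
    rewrite rE -sr -[in RHS](size_map id) map_id.
    rewrite (eq_big_seq (fun=> 'X)) => [|z /r0 ->]; last by rewrite subr0.
    by rewrite big_const_seq count_predT -Monoid.iteropE.
  have := Cayley_Hamilton Y; rewrite cX rmorphXn /= horner_mx_X => Y3.
  by apply: (map_mx_inj (f := real_complex R)); rewrite rmorphXn /= Y3 map_mx0.
move: X1; rewrite expmx_nilpotent3// => X1.
(* Multiplied by X, the equation X + X^2 / 2 = 0 gives X^2 = 0, as X^3 = 0. *)
have h1 : X + 2^-1 *: X ^+ 2 = 0.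
  by apply: (addrI 1); rewrite addrA addr0.
have X2 : X ^+ 2 = 0.
  have : X * (X + 2^-1 *: X ^+ 2) = 0 by rewrite h1 mulr0.
  by rewrite mulrDr -scalerAr -exprS X3 scaler0 addr0.
by move: h1; rewrite X2 scaler0 addr0.
Qed.

(** As [K^3 = - K], an eigenvalue [z] of [t *: K] satisfies
    [z (z^2 + t^2) = 0]. *)
Lemma cross_mx_principal (R : realType) (k : 'cV[R]_3) (t : R) :
  frobnorm k = 1 -> - pi < t < pi ->
  is_principal_log (expmx (t *: cross_mx k)) (t *: cross_mx k).
Proof.
move=> k1 tpi; split=> // z /eigenvalueP[v vX v0].
set X := t *: cross_mx k in vX; set Y := map_mx _ X in vX.
have X3 : X *m X *m X = - t ^+ 2 *: X.
  rewrite /X; do ![rewrite -scalemxAl | rewrite -scalemxAr].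
  rewrite cross_mx_cube// !scalerN !scalerA.
  by rewrite -scaleNr; congr (_ *: _); ring.
have Y3 : Y *m Y *m Y = real_complex R (- t ^+ 2) *: Y.
  by rewrite /Y -!map_mxM X3 map_mxZ.
have /eqP : (z * (z ^+ 2 - real_complex R (- t ^+ 2))) *: v = 0.
  transitivity (v *m (Y *m Y *m Y) - real_complex R (- t ^+ 2) *: (v *m Y)).
    rewrite !mulmxA vX -!scalemxAl vX -!scalemxAl vX !scalerA -scalerBl.
    by congr (_ *: _); ring.
  by rewrite Y3 -scalemxAr subrr.
rewrite scaler_eq0 (negbTE v0) orbF mulf_eq0 => zE.
suff : complex.Im z ^+ 2 <= t ^+ 2.
  move=> h; rewrite -ltr_norml; apply: (@le_lt_trans _ _ `|t|).
    by rewrite -ler_sqr ?nnegrE// !real_normK ?num_real.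
  by rewrite ltr_norml.
case/orP: zE => [/eqP ->|]; first by rewrite /= expr0n sqr_ge0.
rewrite subr_eq0 => /eqP zz.
have := congr1 (@complex.Re R) zz; have := congr1 (@complex.Im R) zz.
rewrite expr2 Re_mul Im_mul /=; set a := complex.Re z; set b := complex.Im z.
move=> h1 h2; have /eqP : a * b = 0 by lra.
by rewrite mulf_eq0 => /orP[]/eqP e; move: h2; rewrite e; nra.
Qed.

Lemma row_norm_eq0 (R : realType) (n : nat) (u : 'rV[R]_n) :
  (u *m u^T) 0 0 = 0 -> u = 0.
Proof.
rewrite !mxE => /eqP; rewrite psumr_eq0 => [/allP u0|i _]; last first.
  by rewrite mxE -expr2 sqr_ge0.
apply/rowP => j; have := u0 j; rewrite mem_index_enum mxE -expr2 sqrf_eq0 mxE.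
by move=> /(_ isT) /eqP.
Qed.

(** For [t != 0] the skew part of the rotation is a nonzero multiple of [K], so
    [X] commutes with [K].  It is then determined by a scalar on the axis and a
    complex number [al + i be] on the orthogonal plane, and these are read off
    from the exponential. *)
Lemma principal_log_cross (R : realType) (k : 'cV[R]_3) (t : R) (X : 'M[R]_3) :
  frobnorm k = 1 -> - pi < t < pi ->
  is_principal_log (expmx (t *: cross_mx k)) X -> X = t *: cross_mx k.
Proof.
move=> k1 tpi [XQ strip]; set K := cross_mx k in XQ *;
  set Q := expmx (t *: _) in XQ.
have [t0|t0] := eqVneq t 0.
  rewrite t0 scale0r; apply: expmx_eq1 => //.
  by rewrite XQ /Q t0 scale0r expmx0.
have st0 := sin_neq0 tpi t0.
have QE : Q = 1%:M + sin t *: K + (1 - cos t) *: (K *m K) by exact: expmx_cross.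
have KT : K^T = - K := cross_mx_skew k.
have QTE : Q^T = 1%:M - sin t *: K + (1 - cos t) *: (K *m K).
  rewrite QE !linearD !linearZ /= trmx1 trmx_mul KT mulNmx mulmxN opprK.
  by rewrite scalerN.
have K3 : K *m K *m K = - K := cross_mx_cube k1.
have K4 : K *m K *m (K *m K) = - (K *m K) by rewrite mulmxA K3 mulNmx.
(* Q is orthogonal, so X commutes with Q^T, the inverse of Q, as well. *)
have QQT : Q *m Q^T = 1%:M.
  have s2 : 2 * (1 - cos t) - (1 - cos t) ^+ 2 - sin t ^+ 2 = 0.
    by rewrite sin2cos2; ring.
  transitivity (1%:M
      + (2 * (1 - cos t) - (1 - cos t) ^+ 2 - sin t ^+ 2) *: (K *m K)).
    rewrite QTE QE !mulmxDl !mulmxDr !mul1mx !mulmxN !mulmx1.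
    do ![rewrite -scalemxAl | rewrite -scalemxAr]; rewrite K4 !mulmxA K3.
    by apply/matrixP => i j; rewrite !mxE; ring.
  by rewrite s2 scale0r addr0.
have QTQ : Q^T *m Q = 1%:M by exact: mulmx1C.
have XQc : X *m Q = Q *m X by rewrite -XQ expmx_comm.
have XQT : X *m Q^T = Q^T *m X.
  by rewrite -[X in X *m _]mul1mx -QTQ -(mulmxA _ Q) -XQc !mulmxA -mulmxA QQT
    mulmx1.
(* The skew part of Q is a nonzero multiple of K. *)
have XK : X *m K = K *m X.
  have dQ : Q - Q^T = (2 * sin t) *: K.
    by rewrite QTE QE; apply/matrixP => i j; rewrite !mxE; ring.
  have : X *m (Q - Q^T) = (Q - Q^T) *m X by rewrite mulmxBr mulmxBl XQc XQT.
  rewrite dQ -scalemxAr -scalemxAl; apply: scalerI.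
  by rewrite mulf_neq0 // pnatr_eq0.
(* The row kernel of K is the axis, which X therefore preserves. *)
have ker (y : 'rV[R]_3) : y *m K = 0 -> y = (y *m k) 0 0 *: k^T.
  move=> yK; have : y *m K *m K = 0 by rewrite yK mul0mx.
  rewrite -mulmxA cross_mx_sqr// mulmxBr mulmx1 mulmxA => /subr0_eq {1}<-.
  by rewrite {1}[y *m k]mx11_scalar mul_scalar_mx.
set r := k^T; set a := (r *m X *m k) 0 0.
have rX : r *m X = a *: r - 0 *: (0 : 'rV_3).
  rewrite scaler0 subr0; apply: ker.
  by rewrite -mulmxA XK mulmxA row_cross_mx mul0mx.
(* A nonzero row in the image of K is orthogonal to the axis; with w = u K it
   spans the plane on which X acts. *)
have [q u0] : exists q : 'rV[R]_3, q *m K != 0.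
  have /rowV0Pn[u /submxP[q ->] u0] : K != 0; last by exists q.
  apply/eqP => K0; have := tr_cross_mx_trmx k1; rewrite -/K K0 mul0mx mxtrace0.
  by move/esym/eqP; rewrite pnatr_eq0.
set u := q *m K in u0; set w := u *m K.
have uk : u *m k = 0 by rewrite -mulmxA cross_mx_col mulmx0.
have uXk : u *m X *m k = 0.
  by rewrite /u -(mulmxA q) -XK -!mulmxA cross_mx_col !mulmx0.
have wK : w *m K = - u.
  by rewrite /w -mulmxA cross_mx_sqr// mulmxBr mulmxA uk mul0mx sub0r mulmx1.
pose n := (u *m u^T) 0 0.
have frame := plane_frame q k1; rewrite -/K -/u -/w -/n in frame.
have n0 : n != 0 by apply: contra_neq u0; exact: row_norm_eq0.
pose al := (u *m X *m u^T) 0 0 / n; pose be := (u *m X *m w^T) 0 0 / n.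
have uX : u *m X = al *: u - be *: - w.
  apply: (scalerI n0); transitivity (u *m X *m (n *: (1%:M - k *m k^T))).
    by rewrite -scalemxAr mulmxBr mulmx1 mulmxA uXk mul0mx subr0.
  rewrite -frame mulmxDr !(mulmxA (u *m X)).
  rewrite [_ *m u^T]mx11_scalar [_ *m w^T]mx11_scalar !mul_scalar_mx.
  by rewrite scalerN opprK scalerDr !scalerA !(mulrC n) !divfK.
have wX : - w *m X = be *: u + al *: - w.
  rewrite mulNmx /w -mulmxA -XK mulmxA uX mulmxBl -!scalemxAl mulNmx wK opprK.
  by rewrite opprB scalerN.
(* The same plane for X and for t K, whose exponentials agree. *)
have [uQ _] := expmx_invariant_plane uX wX.
have [uQ' _] : u *m Q = (expR 0 * cos t) *: u - (expR 0 * sin t) *: - w /\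
   - w *m Q = (expR 0 * sin t) *: u + (expR 0 * cos t) *: - w.
  apply: expmx_invariant_plane.
    by rewrite -scalemxAr scale0r sub0r scalerN opprK.
  by rewrite -scalemxAr mulNmx wK opprK scale0r addr0.
rewrite XQ in uQ; rewrite uQ expR0 !mul1r !scalerN !opprK in uQ'.
have wu : (w *m u^T) 0 0 = 0.
  have : (w *m u^T)^T = - (w *m u^T).
    by rewrite trmx_mul trmxK /w trmx_mul KT mulmxA mulmxN mulNmx.
  move/matrixP/(_ 0 0); rewrite [LHS]mxE [RHS]mxE => /eqP.
  by rewrite eq_sym eqNr => /eqP.
have uw : (u *m w^T) 0 0 = 0.
  by rewrite -[u]trmxK -trmx_mul mxE wu.
have ww : (w *m w^T) 0 0 = n.
  by rewrite {2}/w trmx_mul KT mulmxA mulmxN wK opprK.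
have entry (c s : R) (y : 'cV_3) : ((c *: u + s *: w) *m y) 0 0 =
    c * (u *m y) 0 0 + s * (w *m y) 0 0.
  by rewrite mulmxDl -!scalemxAl !mxE.
have ceq : expR al * cos be = cos t.
  apply: (mulIf n0); have := congr1 (fun y : 'rV_3 => (y *m u^T) 0 0) uQ'.
  by rewrite /= !entry wu !mulr0 !addr0.
have seq : expR al * sin be = sin t.
  apply: (mulIf n0); have := congr1 (fun y : 'rV_3 => (y *m w^T) 0 0) uQ'.
  by rewrite /= !entry uw ww !mulr0 !add0r.
have al0 : al = 0.
  have : expR al ^+ 2 = 1.
    transitivity (expR al ^+ 2 * (cos be ^+ 2 + sin be ^+ 2)).
      by rewrite cos2Dsin2 mulr1.
    by rewrite mulrDr -!exprMn ceq seq cos2Dsin2.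
  move/eqP; rewrite sqrf_eq1 => /orP[/eqP e|/eqP e].
    by apply: expR_inj; rewrite expR0.
  by have := expR_gt0 al; rewrite e oppr_gt0 ltr10.
rewrite al0 expR0 !mul1r in ceq seq.
(* The row u - i w is an eigenvector of X for al + i be. *)
have bepi : - pi < be < pi.
  apply: (strip (Complex al be)); apply/complex_eigenvalueP.
  by exists u, (- w); split => //; left.
have bt : be = t by exact: cos_sin_inj.
have a0 : a = 0.
  have [rQ _] : r *m expmx X = (expR a * cos 0) *: r - (expR a * sin 0) *: 0 /\
      (0 : 'rV_3) *m expmx X = (expR a * sin 0) *: r + (expR a * cos 0) *: 0.
    apply: expmx_invariant_plane => //.
    by rewrite mul0mx scale0r scaler0 addr0.
  move: rQ; rewrite cos0 mulr1 scaler0 subr0 XQ QE !mulmxDr mulmx1 -!scalemxAr.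
  rewrite mulmxA row_cross_mx mul0mx !scaler0 !addr0.
  move/(congr1 (fun y : 'rV_3 => \tr (y^T *m r))).
  rewrite /= linearZ /= -scalemxAl mxtraceZ trmxK col_outer mxtrace3 !mxE /=.
  by rewrite -!expr2 unit_colP// mulr1 => /esym e; apply: expR_inj;
    rewrite expR0.
(* X and t K agree on u, w and k^T, which span everything. *)
apply: (scalerI n0).
have I : n%:M = u^T *m u + w^T *m w + n *: (k *m k^T).
  by rewrite frame scalerBr subrK scale_scalar_mx mulr1.
rewrite -[n *: X]mul_scalar_mx -[n *: (t *: K)]mul_scalar_mx I !mulmxDl
  -!scalemxAl.
have wX' : w *m X = - (be *: u + al *: - w) by rewrite -wX mulNmx opprK.
rewrite -!(mulmxA u^T) -!(mulmxA w^T) -!(mulmxA k) -/r rX uX wX' al0 bt a0.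
rewrite -!(scalemxAr t _ K) row_cross_mx wK -/w.
by rewrite !scale0r !scaler0 !subr0 !addr0 !sub0r !scalerN opprK.
Qed.

Lemma logmx_cross (R : realType) (k : 'cV[R]_3) (t : R) :
  frobnorm k = 1 -> - pi < t < pi ->
  logmx (expmx (t *: cross_mx k)) = t *: cross_mx k.
Proof.
move=> k1 tpi; apply: xget_unique; first exact: cross_mx_principal.
by move=> X; exact: principal_log_cross.
Qed.

(** * The Frobenius norm and the two distances *)

Lemma tr_mulmx_trmx (R : realType) (m n : nat) (X Y : 'M[R]_(m, n)) :
  \tr (X *m Y^T) = \sum_i \sum_j X i j * Y i j.
Proof.
by apply: eq_bigr => i _; rewrite mxE; apply: eq_bigr => j _; rewrite mxE.
Qed.

Lemma frobnorm_sqr (R : realType) (m n : nat) (X : 'M[R]_(m, n)) :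
  frobnorm X ^+ 2 = \tr (X *m X^T).
Proof.
rewrite /frobnorm sqr_sqrtr// tr_mulmx_trmx; apply: sumr_ge0 => i _.
by apply: sumr_ge0 => j _; rewrite -expr2 sqr_ge0.
Qed.

Lemma frobnormZ_sqr (R : realType) (n : nat) (X : 'M[R]_n) (c : R) :
  frobnorm (c *: X) ^+ 2 = c ^+ 2 * frobnorm X ^+ 2.
Proof.
rewrite !frobnorm_sqr linearZ /= -scalemxAl -scalemxAr scalerA mxtraceZ.
by rewrite expr2.
Qed.

Lemma frobnorm_conj (R : realType) (n : nat) (P X : 'M[R]_n) :
  P *m P^T = 1%:M -> frobnorm (P^T *m X *m P) = frobnorm X.
Proof.
move=> PP; rewrite /frobnorm !trmx_mul trmxK !mulmxA.
by rewrite -(mulmxA (P^T *m X) P) PP mulmx1 mxtrace_mulC !mulmxA PP mul1mx.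
Qed.

Lemma dR_cross (R : realType) (QA QB : 'M[R]_3) (k : 'cV[R]_3) (t : R) :
  frobnorm k = 1 -> - pi < t < pi -> QA *m QB^T = expmx (t *: cross_mx k) ->
  dR QA QB ^+ 2 = t ^+ 2.
Proof.
move=> k1 tpi QE; rewrite /dR QE logmx_cross// exprMn frobnorm_sqr.
rewrite linearZ /= -scalemxAl -scalemxAr !mxtraceZ tr_cross_mx_trmx//.
by rewrite exprVn sqr_sqrtr//; field.
Qed.

(** As [QB = Q^T *m QA], the second matrix is the conjugate of
    [Q *m LB *m Q^T] by [QA], which also conjugates [LA] to the first one. *)
Lemma dC_rotation (R : realType) (QA QB LA LB : 'M[R]_3) (Q := QA *m QB^T) :
  SO QA -> SO QB ->
  dC (QA^T *m LA *m QA) (QB^T *m LB *m QB) =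
  frobnorm (commutator LA (Q *m LB *m Q^T)).
Proof.
move=> [QA1 _] [QB1 _]; have QA2 := mulmx1C QA1; have QB2 := mulmx1C QB1.
rewrite /dC -[RHS](frobnorm_conj _ QA1); congr frobnorm; rewrite /commutator.
rewrite mulmxBr mulmxBl /Q trmx_mul trmxK !mulmxA.
congr (_ - _).
  by rewrite -[in RHS](mulmxA _ QA^T) QA2 mulmx1.
by rewrite QA2 mul1mx.
Qed.

(** * The leading coefficient *)

(** With [K i j] up to sign a coordinate of [k], this is the sum over pairs of
    indices of [((la i - la j) (lb i - lb j) K i j)^2], each unordered pair
    being counted twice. *)
Definition gap_form (R : realType) (k : 'cV[R]_3) (la lb : 'rV[R]_3) : R :=
  2 * (((la 0 0 - la 0 1) * (lb 0 0 - lb 0 1) * k 2 0) ^+ 2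
     + ((la 0 0 - la 0 2) * (lb 0 0 - lb 0 2) * k 1 0) ^+ 2
     + ((la 0 1 - la 0 2) * (lb 0 1 - lb 0 2) * k 0 0) ^+ 2).

Lemma Cconst_gap (R : realType) (k : 'cV[R]_3) (la lb : 'rV[R]_3) :
  Cconst (cross_mx k) (diag_mx la) (diag_mx lb) = gap_form k la lb.
Proof.
rewrite /Cconst /gap_form !expr2.
rewrite -!mulmxE cross_mxE !diag_mx3 !mx3_mul !(mx3_sub, mx3_add) !mx3_tr.
ring.
Qed.

Lemma commutator_gap (R : realType) (k : 'cV[R]_3) (la lb : 'rV[R]_3) :
  frobnorm (commutator (diag_mx la) (commutator (cross_mx k) (diag_mx lb)))
    ^+ 2 = gap_form k la lb.
Proof.
rewrite frobnorm_sqr /commutator /gap_form cross_mxE !diag_mx3.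
rewrite !(mx3_mul, mx3_sub) mx3_trmx mx3_mul mx3_tr.
ring.
Qed.

(** Both spectra are decreasing, so the products of gaps are positive, and the
    square of the least of them bounds the form on the unit sphere. *)
Lemma gap_form_lower (R : realType) (la lb : 'rV[R]_3) :
  la 0 0 > la 0 1 /\ la 0 1 > la 0 2 -> lb 0 0 > lb 0 1 /\ lb 0 1 > lb 0 2 ->
  exists2 m : R, 0 < m &
    forall k, frobnorm k = 1 -> m <= gap_form k la lb.
Proof.
move=> [a01 a12] [b01 b12].
pose g01 := (la 0 0 - la 0 1) * (lb 0 0 - lb 0 1).
pose g02 := (la 0 0 - la 0 2) * (lb 0 0 - lb 0 2).
pose g12 := (la 0 1 - la 0 2) * (lb 0 1 - lb 0 2).
have g01_gt0 : 0 < g01 by rewrite mulr_gt0 ?subr_gt0.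
have g02_gt0 : 0 < g02 by rewrite mulr_gt0 ?subr_gt0 ?(lt_trans a12) ?(lt_trans
  b12).
have g12_gt0 : 0 < g12 by rewrite mulr_gt0 ?subr_gt0.
pose g := Num.min g01 (Num.min g02 g12).
have g_gt0 : 0 < g by rewrite !lt_min g01_gt0 g02_gt0.
have [l01 l02 l12] : [/\ g <= g01, g <= g02 & g <= g12].
  by rewrite /g; split; rewrite !ge_min lexx ?orbT.
exists (2 * g ^+ 2); first by rewrite mulr_gt0// exprn_gt0.
move=> k /unit_colP k1; rewrite /gap_form -/g01 -/g02 -/g12.
have sq c x : g <= c -> g ^+ 2 * x ^+ 2 <= (c * x) ^+ 2.
  move=> gc; rewrite exprMn ler_wpM2r ?sqr_ge0// ler_sqr ?nnegrE//;
    first exact: ltW.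
  by apply: le_trans gc; exact: ltW.
have gk :
    g ^+ 2 = g ^+ 2 * k 0 0 ^+ 2 + g ^+ 2 * k 1 0 ^+ 2 + g ^+ 2 * k 2 0 ^+ 2.
  by rewrite -!mulrDr k1 mulr1.
have := sq _ (k 0 0) l12; have := sq _ (k 1 0) l02; have := sq _ (k 2 0) l01.
lra.
Qed.

(** * The remainder of the commutator *)

Lemma norm_sin_le (R : realType) (x : R) : `|sin x| <= `|x|.
Proof.
wlog x0 : x / 0 <= x => [H|].
  by have [/H //|/ltW x0] := leP 0 x; rewrite -normrN -sinN -[leRHS]normrN H//
    oppr_ge0.
have [|c _] := @MVT_segment R sin cos 0 x x0 (fun y _ => is_derive_sin y).
  by apply: continuous_subspaceT => y; exact: continuous_sin.
rewrite sin0 !subr0 => ->; rewrite normrM ler_piMl// cos_max//.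
Qed.

Lemma one_minus_cos (R : realType) (x : R) : 0 <= 1 - cos x <= x ^+ 2.
Proof.
rewrite subr_ge0 cos_le1 /=.
have -> : cos x = 1 - 2 * sin (x / 2) ^+ 2.
  rewrite {1}(_ : x = (x / 2) *+ 2); last by rewrite -mulr_natr divfK.
  by rewrite cos_mulr2n cos2sin2; ring.
have : sin (x / 2) ^+ 2 <= (x / 2) ^+ 2.
  by rewrite -[leLHS]real_normK ?num_real// -[leRHS]real_normK ?num_real//
    ler_sqr ?nnegrE// norm_sin_le.
have := sqr_ge0 x; nra.
Qed.

(** By the mean value theorem, [x - sin x] is [x] times a value of [1 - cos]
    between [0] and [x]. *)
Lemma sin_sub_le (R : realType) (x : R) : `|x - sin x| <= `|x| ^+ 3.
Proof.
wlog x0 : x / 0 <= x => [H|].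
  have [/H //|/ltW x0] := leP 0 x.
  by have := H (- x); rewrite oppr_ge0 sinN -opprD !normrN; apply.
have [|c] := @MVT_segment R (fun y => y - sin y) (fun y => 1 - cos y) 0 x x0 _.
  apply: continuous_subspaceT => y; apply: cvgB;
    [exact: cvg_id|exact: continuous_sin].
rewrite in_itv /= sin0 !subr0 => /andP[c0 cx] ->.
have /andP[h1 h2] := one_minus_cos c.
rewrite normrM !ger0_norm//.
have : c ^+ 2 <= x ^+ 2 by rewrite ler_sqr.
rewrite exprSr; nra.
Qed.

Lemma sin_sqr_approx (R : realType) (x : R) : `|x| <= 1 ->
  `|x ^+ 2 - sin x ^+ 2| <= 2 * `|x| ^+ 3.
Proof.
move=> x1; rewrite subr_sqr normrM.
have h : `|x + sin x| <= 2 * `|x|.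
  by have := norm_sin_le x; have := ler_normD x (sin x); lra.
have := sin_sub_le x; have := normr_ge0 (x - sin x);
  have := normr_ge0 (x + sin x).
rewrite exprSr; have := normr_ge0 x; nra.
Qed.

Lemma mx_norm_commutator (R : realType) (n : nat) (A B : 'M[R]_n) :
  `|commutator A B| <= 2 * (n%:R * (`|A| * `|B|)).
Proof.
apply: le_trans (ler_normB _ _) _.
have := mx_normM A B; have := mx_normM B A; rewrite (mulrC `|B|); lra.
Qed.

Lemma tr_mulmx_trmx_le (R : realType) (n : nat) (X Y : 'M[R]_n) :
  `|\tr (X *m Y^T)| <= n%:R * (n%:R * (`|X| * `|Y|)).
Proof.
rewrite tr_mulmx_trmx.
have sum_le (F : 'I_n -> R) (b : R) :
    (forall i, `|F i| <= b) -> `|\sum_i F i| <= n%:R * b.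
  move=> Fb; apply: le_trans (ler_norm_sum _ _ _) _.
  by rewrite mulr_natl -[X in _ *+ X]card_ord -sumr_const ler_sum.
by do 2!apply: (sum_le) => ?; rewrite normrM ler_pM ?le_mx_norm.
Qed.

Lemma frobnorm_sqrD (R : realType) (n : nat) (X Y : 'M[R]_n) :
  `|frobnorm (X + Y) ^+ 2 - frobnorm X ^+ 2| <=
  n%:R * (n%:R * (2 * `|X| * `|Y| + `|Y| ^+ 2)).
Proof.
rewrite !frobnorm_sqr linearD /= mulmxDl !mulmxDr !mxtraceD.
have := tr_mulmx_trmx_le X Y; have := tr_mulmx_trmx_le Y X;
  have := tr_mulmx_trmx_le Y Y.
rewrite (mulrC `|Y| `|X|) => hYY hYX hXY.
have -> : \tr (X *m X^T) + \tr (X *m Y^T)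
    + (\tr (Y *m X^T) + \tr (Y *m Y^T)) - \tr (X *m X^T) =
    \tr (X *m Y^T) + \tr (Y *m X^T) + \tr (Y *m Y^T) by ring.
apply: le_trans (ler_normD _ _) _; apply: le_trans (lerD (ler_normD _ _) (lexx
  _)) _.
lra.
Qed.

Lemma commutatorDr (R : realType) (n : nat) (A X Y : 'M[R]_n) :
  commutator A (X + Y) = commutator A X + commutator A Y.
Proof. by rewrite /commutator mulmxDr mulmxDl opprD addrACA. Qed.

Lemma commutatorZr (R : realType) (n : nat) (A X : 'M[R]_n) (c : R) :
  commutator A (c *: X) = c *: commutator A X.
Proof. by rewrite /commutator -scalemxAr -scalemxAl scalerBr. Qed.

(** The terms of order at least two in [x] of [Q L Q^T], for [s = sin x],
    [t = 1 - cos x] and [Q = 1 + s K + t K^2]; note that [t] is itself of order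
    two. *)
Definition rot_remainder (R : realType) (K L : 'M[R]_3) (s t : R) : 'M[R]_3 :=
  t *: (K *m K *m L + L *m (K *m K)) - s ^+ 2 *: (K *m L *m K)
  + (s * t) *: commutator (K *m L *m K) K
  + t ^+ 2 *: (K *m K *m L *m (K *m K)).

(** The term of order zero of [Q LB Q^T] is [LB], which commutes with [LA]. *)
Lemma commutator_rotation (R : realType) (LA LB K : 'M[R]_3) (s t : R)
    (Q : 'M[R]_3 := 1%:M + s *: K + t *: (K *m K)) :
  LA *m LB = LB *m LA -> K^T = - K ->
  commutator LA (Q *m LB *m Q^T) =
  s *: commutator LA (commutator K LB) + commutator LA (rot_remainder K LB s t).
Proof.
move=> AB KT.
have QT : Q^T = 1%:M - s *: K + t *: (K *m K).
  by rewrite !linearD !linearZ /= trmx1 trmx_mul KT mulNmx mulmxN opprK scalerN.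
have -> : Q *m LB *m Q^T = LB + (s *: commutator K LB + rot_remainder K LB s t).
  rewrite QT /Q /rot_remainder /commutator.
  rewrite !(mulmxDl, mulmxDr, mulmxBr, mulmxBl, mulmxN, mulNmx, mul1mx, mulmx1).
  do ![rewrite -scalemxAl | rewrite -scalemxAr]; rewrite !mulmxA.
  move: (K *m LB *m K *m K) (K *m K *m LB *m K) (K *m K *m LB *m K *m K).
  move: (LB *m K) (K *m LB) (LB *m K *m K) (K *m K *m LB) (K *m LB *m K).
  have lin (l a b c d e f g h : R) :
      l - s * a + t * b + (s * c - s * (s * d) + s * (t * e))
      + (t * f - t * (s * g) + t * (t * h)) =
      l + (s * (c - a) + (t * (f + b) - s ^+ 2 * d
      + s * t * (e - g) + t ^+ 2 * h)) by ring.
  by move=> *; apply/matrixP => i j; rewrite !mxE; exact: lin.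
have AB0 : commutator LA LB = 0 by rewrite /commutator AB subrr.
by rewrite (commutatorDr _ LB) (commutatorDr _ (s *: _)) (commutatorZr _ _ s)
  AB0 add0r.
Qed.

(** Each of the four terms has a coefficient at most [e^2]; the numerical
    factors are the powers of three lost at each product of matrices of size
    three. *)
Lemma rot_remainder_le (R : realType) (K L : 'M[R]_3) (s t e : R) :
  `|K| <= 1 -> 0 <= e <= 1 -> `|s| <= e -> 0 <= t <= e ^+ 2 ->
  `|rot_remainder K L s t| <= 162 * `|L| * e ^+ 2.
Proof.
move=> K1 /andP[e0 e1] se /andP[t0 te].
set l := `|L|; have l0 : 0 <= l by exact: normr_ge0.
have KK : `|K *m K| <= 3 by have := mx_normM_le K1 K1; rewrite !mulr1.
have KL : `|K *m L| <= 3 * l by have := mx_normM_le K1 (lexx l); rewrite mul1r.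
have KLK : `|K *m L *m K| <= 9 * l by have := mx_normM_le KL K1; lra.
have KKL : `|K *m K *m L| <= 9 * l by have := mx_normM_le KK (lexx l); lra.
have LKK : `|L *m (K *m K)| <= 9 * l by have := mx_normM_le (lexx l) KK; lra.
have KKLKK : `|K *m K *m L *m (K *m K)| <= 81 * l.
  by have := mx_normM_le KKL KK; lra.
have cKLK : `|commutator (K *m L *m K) K| <= 54 * l.
  apply: le_trans (mx_norm_commutator _ _) _.
  have : `|K *m L *m K| * `|K| <= 9 * l * 1 by apply: ler_pM.
  lra.
have s2 : s ^+ 2 <= e ^+ 2 by rewrite -real_normK ?num_real// ler_sqr.
have st : `|s * t| <= e ^+ 2.
  by rewrite normrM (ger0_norm t0); have := normr_ge0 s; nra.
have t1 : t <= 1 by apply: le_trans te _; rewrite exprn_ile1.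
have t2 : t ^+ 2 <= e ^+ 2 by apply: le_trans te; rewrite expr2 ler_piMl.
have e2 : 0 <= e ^+ 2 := sqr_ge0 e.
have scal (c b : R) (X : 'M[R]_3) :
    `|c| <= e ^+ 2 -> `|X| <= b -> `|c *: X| <= e ^+ 2 * b.
  by move=> hc hX; rewrite normrZ ler_pM.
have h1 : `|t *: (K *m K *m L + L *m (K *m K))| <= e ^+ 2 * (18 * l).
  apply: scal; first by rewrite ger0_norm.
  by apply: le_trans (ler_normD _ _) _; lra.
have h2 : `|s ^+ 2 *: (K *m L *m K)| <= e ^+ 2 * (9 * l).
  by apply: scal => //; rewrite ger0_norm ?sqr_ge0.
have h3 : `|(s * t) *: commutator (K *m L *m K) K| <= e ^+ 2 * (54 * l).
  exact: scal.
have h4 : `|t ^+ 2 *: (K *m K *m L *m (K *m K))| <= e ^+ 2 * (81 * l).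
  by apply: scal => //; rewrite ger0_norm ?sqr_ge0.
apply: le_trans (ler_normD _ _) _; apply: le_trans (lerD (ler_normD _ _) h4) _.
apply: le_trans (lerD (lerD (ler_normB _ _) h3) (lexx _)) _; lra.
Qed.

(** The squared norm of [s P + D], with [P] bounded and [D] of order [x^2], is
    [s^2] times that of [P] up to order [x^3].  The constant does not depend on
    [K], since [K] ranges over a bounded set. *)
Lemma commutator_rotation_approx (R : realType) (LA LB : 'M[R]_3) :
  LA *m LB = LB *m LA ->
  exists2 c : R, 0 <= c &
  forall (K : 'M[R]_3) (x : R), K^T = - K -> `|K| <= 1 -> `|x| <= 1 ->
  let Q := 1%:M + sin x *: K + (1 - cos x) *: (K *m K) in
  `|frobnorm (commutator LA (Q *m LB *m Q^T)) ^+ 2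
    - sin x ^+ 2 * frobnorm (commutator LA (commutator K LB)) ^+ 2|
  <= c * `|x| ^+ 3.
Proof.
(* Each of the two commutators in P costs a factor 2 * 3; then D is bounded by
   27 p x^2, and 7047 = 9 * (2 * 27 + 27 ^ 2). *)
move=> AB; pose p : R := 36 * `|LA| * `|LB|.
exists (7047 * p ^+ 2); first exact: mulr_ge0 (ler0n _ _) (sqr_ge0 _).
move=> K x KT K1 x1 /=; rewrite commutator_rotation//.
set P := commutator LA (commutator K LB).
set D := commutator LA (rot_remainder _ _ _ _).
rewrite -frobnormZ_sqr; apply: le_trans (frobnorm_sqrD _ _) _.
set e := `|x|; have e0 : 0 <= e by exact: normr_ge0.
have p0 : 0 <= p by rewrite /p !mulr_ge0.
have hP : `|P| <= p.
  apply: le_trans (mx_norm_commutator _ _) _.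
  have h : `|commutator K LB| <= 6 * `|LB|.
    apply: le_trans (mx_norm_commutator _ _) _.
    have : `|K| * `|LB| <= 1 * `|LB| by rewrite ler_wpM2r.
    by lra.
  have : `|LA| * `|commutator K LB| <= `|LA| * (6 * `|LB|) by rewrite ler_wpM2l.
  by rewrite /p; lra.
have hD : `|D| <= 27 * p * e ^+ 2.
  apply: le_trans (mx_norm_commutator _ _) _.
  have h : `|rot_remainder K LB (sin x) (1 - cos x)| <= 162 * `|LB| * e ^+ 2.
    apply: rot_remainder_le => //.
    - by rewrite e0.
    - exact: norm_sin_le.
    - by rewrite real_normK ?num_real// one_minus_cos.
  have : `|LA| * `|rot_remainder K LB (sin x) (1 - cos x)|
      <= `|LA| * (162 * `|LB| * e ^+ 2) by rewrite ler_wpM2l.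
  by rewrite /p; lra.
have hsP : `|sin x *: P| <= e * p by rewrite normrZ ler_pM// norm_sin_le.
have h1 : `|sin x *: P| * `|D| <= (e * p) * (27 * p * e ^+ 2) by rewrite ler_pM.
have h2 : `|D| ^+ 2 <= 729 * p ^+ 2 * e ^+ 3.
  apply: (@le_trans _ _ ((27 * p * e ^+ 2) ^+ 2)).
    by rewrite ler_sqr ?nnegrE// !mulr_ge0.
  have : e ^+ 4 <= e ^+ 3 by rewrite exprS ler_piMl// exprn_ge0.
  have := sqr_ge0 p; nra.
lra.
Qed.

(** * Comparison of the two distances *)

Theorem lemma3p4 (R : realType) (la lb : 'rV[R]_3)
  (hla : la 0 0 > la 0 1 /\ la 0 1 > la 0 2)
  (hlb : lb 0 0 > lb 0 1 /\ lb 0 1 > lb 0 2) :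
  exists2 M : R, 0 < M &
  \forall theta \near (0 : R),
  forall (QA QB : 'M[R]_3) (k : 'cV[R]_3),
    SO QA -> SO QB -> frobnorm k = 1 ->
    - pi < theta < pi ->
    QA *m QB^T = expmx (theta *: cross_mx k) ->
    let LA := diag_mx la in
    let LB := diag_mx lb in
    let A := QA^T *m LA *m QA in
    let B := QB^T *m LB *m QB in
    `| dR QA QB ^+ 2 - dC A B ^+ 2 / Cconst (cross_mx k) LA LB |
      <= M * `| theta | ^+ 3.
Proof.
have [m m0 gap] := gap_form_lower hla hlb.
have ABc : diag_mx la *m diag_mx lb = diag_mx lb *m diag_mx la.
  by rewrite !mulmx_diag; congr diag_mx; apply/rowP => j; rewrite !mxE mulrC.
have [c c0 approx] := commutator_rotation_approx ABc.
exists (2 + c / m); first by rewrite ltr_wpDr// divr_ge0// ltW.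
near=> theta; have t1 : `|theta| <= 1.
  by near: theta; exact: (@nbhs0_le R R^o 1 ltr01).
move=> QA QB k SQA SQB k1 tpi QE.
set LA := diag_mx la; set LB := diag_mx lb.
rewrite (dR_cross k1 tpi QE) dC_rotation// QE expmx_cross// Cconst_gap.
have mN := gap _ k1; set N := gap_form k la lb in mN *.
have N0 : 0 < N := lt_le_trans m0 mN.
have := approx _ _ (cross_mx_skew k) (norm_cross_mx_le1 k1) t1.
rewrite /= commutator_gap -/N; set F := frobnorm _ ^+ 2 => hF.
(* The error of sin, and that of the commutator divided by N >= m. *)
have -> : theta ^+ 2 - F / N =
    (theta ^+ 2 - sin theta ^+ 2) - (F - sin theta ^+ 2 * N) / N.
  by field; rewrite gt_eqF.
apply: le_trans (ler_normB _ _) _; rewrite [leRHS]mulrDl lerD//;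
  first exact: sin_sqr_approx.
rewrite normrM normfV (gtr0_norm N0) [leRHS]mulrAC ler_pM// ?invr_ge0 ?(ltW
  N0)//.
by rewrite lef_pV2.
Unshelve. all: by end_near. Qed.
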